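(* Let $d\ge 2$ be an integer and let $0<\varepsilon<1/2$. Let $G=(V,E)$ be a graph on $n$ vertices of minimum degree $\delta=\delta(G)$ and maximum degree $\Delta=\Delta(G)$. Suppose that $n,\delta,\Delta$ and $G$ satisfy: 1. (the order of the graph is large enough) $$n\ge \frac{480\,d^3\log(2/\varepsilon)}{\varepsilon};$$ 2. (the maximum degree is not too large compared to the minimum degree) $$\Delta^2\le \frac1K\, e^{\delta/(8K)-1},\qquad\text{where } K=\frac{20\,d^2\log(2/\varepsilon)}{\varepsilon};$$ 3. (local expansion) every induced subgraph $G_0$ of $G$ with minimum degree at least $\dfrac{\varepsilon\,\delta}{40\,d^2\log(2/\varepsilon)}$ is a $\left(\frac{1}{2d+2},\,d+1\right)$-expander. Then $G$ contains a copy (as a not necessarily induced subgraph) of every tree $T$ on at most $(1-\varepsilon)n$ vertices of maximum degree at most $d$.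
   Context: All graphs are finite and simple. For a graph $H$ and $X\subset V(H)$, $N_H(X)$ denotes the set of all neighbors in $H$ of vertices of $X$ (it may contain vertices of $X$). Given two positive numbers $c$ and $\alpha<1$, a graph $H$ is called an $(\alpha,c)$-expander if every subset of vertices $X\subset V(H)$ of size $|X|\le\alpha|V(H)|$ satisfies $|N_H(X)|\ge c|X|$. $\log$ is the natural logarithm. *)

(* Defs.v *)
From HB Require Import structures.
From mathcomp Require Import all_boot all_order all_algebra.
From mathcomp Require Import reals.

Set Implicit Arguments.
Unset Strict Implicit.
Unset Printing Implicit Defensive.

Import Order.TTheory GRing.Theory Num.Theory.

Local Open Scope nat_scope.

Record sgraph := SGraph {
  vertex :> finType;
  edge : rel vertex;
  edge_sym : symmetric edge;
  edge_irr : irreflexive edge }.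

Definition nbrs (H : sgraph) (X : {set H}) : {set H} :=
  [set y | [exists x in X, edge x y]].

Definition vdegree (H : sgraph) (x : H) : nat := #|[set y | edge x y]|.

(* Every degree is less than #|H|, so the neutral element #|H| does not affect
   the minimum when H is nonempty; the empty graph has mindeg 0. *)
Definition mindeg (H : sgraph) : nat := \big[minn/#|H|]_(x : H) vdegree x.

Definition maxdeg (H : sgraph) : nat := \max_(x : H) vdegree x.

Section Induced.
Variables (H : sgraph) (U : {set H}).

Definition induced_edge : rel {x : H | x \in U} :=
  fun x y => edge (val x) (val y).

Lemma induced_sym : symmetric induced_edge.
Proof. by move=> x y; apply: edge_sym. Qed.

Lemma induced_irr : irreflexive induced_edge.
Proof. by move=> x; apply: edge_irr. Qed.

Definition induced_sub : sgraph := SGraph induced_sym induced_irr.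
End Induced.

Definition expander (R : realType) (alpha c : R) (H : sgraph) : Prop :=
  forall X : {set H},
    (#|X|%:R <= alpha * #|H|%:R)%R -> (c * #|X|%:R <= #|nbrs X|%:R)%R.

Definition connected_graph (H : sgraph) : Prop :=
  0 < #|H| /\ forall x y : H, connect (@edge H) x y.

(* ucycle also holds of [::], [:: x; y] with x, y adjacent; genuine cycles of
   a simple graph have at least three vertices. *)
Definition acyclic (H : sgraph) : Prop :=
  forall s : seq H, ucycle (@edge H) s -> size s < 3.

Definition is_tree (H : sgraph) : Prop := connected_graph H /\ acyclic H.

Definition contains_copy (G T : sgraph) : Prop :=
  exists f : T -> G,
    injective f /\ forall x y : T, edge x y -> edge (f x) (f y).

(* Main.v *)
Require Import Defs.
From HB Require Import structures.
From mathcomp Require Import all_boot all_order all_algebra.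
From mathcomp Require Import reals sequences exp.
From mathcomp Require Import ring lra zify.

Set Implicit Arguments.
Unset Strict Implicit.
Unset Printing Implicit Defensive.

Import Order.TTheory GRing.Theory Num.Theory.

Local Open Scope ring_scope.

(** Why the theorem holds. The engine is the embedding theorem of Friedman and
Pippenger ([rooted_tree_embedding]): a graph in which every vertex set X with
at most 2(k - 1) elements has at least (d + 1)|X| neighbours contains every
rooted tree on k vertices with at most d children per vertex, and the image of
the root can be prescribed. A (1/(2d+2), d+1)-expander on N vertices thus only
receives trees on about N/(4d+4) vertices, so T is cut into pieces that are
embedded one after the other, each in the graph induced on the vertices that
are still free.

To apply local expansion at every stage, the free vertices must induce a graph
of large minimum degree, however badly the earlier pieces were placed. This is
what the random colouring is for: by the local lemma [local_lemma] and the
Chernoff bound [card_few_colour], V(G) has a colouring with P = floor(K)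
colours in which every vertex has at least delta/(2K) neighbours of every
colour ([exists_balanced_colouring]). A set J of s colours, covering at most
eps n/2 vertices, is reserved, and each stage releases one fresh colour of J.
No vertex of that colour has been used, so the free vertices induce a graph of
minimum degree at least delta/(2K), and the vertex to which the next piece must
be attached has a free neighbour where that piece can be rooted.

It remains to see that s stages suffice. Let rho = eps n/2, and let z be rho
plus the number of vertices of T that are still missing; write z' for its value
after the current stage. At least z >= z' vertices of G are free, so a piece of
about z'/(4d+4) vertices fits. As T has maximum degree at most d, there is a
subtree whose size is between 1/d of this bound and the bound itself
([exists_subtree_size]), so z >= z' (1 + 1/(4d(d+1))). Since z starts below
n = rho (2/eps) and never falls below rho, (2d+1)^2 log(2/eps) stages are enough
([growth_ge]), while the bound on the maximum degree pays for about
20 d^2 log(2/eps)/eps colours, at least 2s/eps. As the size of a piece depends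
on what remains after it, the subtrees are cut off T from below and embedded in
the reverse order; [staged_embedding] performs both in one induction. *)

(** * Independence and the local lemma *)

Lemma leq_card_bigcup (I T : finType) (A : pred I) (F : I -> {set T}) :
  (#|\bigcup_(i | A i) F i| <= \sum_(i | A i) #|F i|)%N.
Proof.
elim/big_rec2: _ => [|i m U _ IH]; first by rewrite cards0.
by apply: leq_trans (leq_card_setU _ _) _; rewrite leq_add2l.
Qed.

Section SwapCoordinates.
Variables (I C : finType) (S : {set I}).
Local Notation Omega := {ffun I -> C}.

Definition swap_off (p : Omega * Omega) : Omega * Omega :=
  ([ffun x => if x \in S then p.1 x else p.2 x],
   [ffun x => if x \in S then p.2 x else p.1 x]).

Lemma swap_offK : involutive swap_off.
Proof.
case=> f g; rewrite /swap_off /=.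
by congr (_, _); apply/ffunP=> x; rewrite !ffunE /= ; case: (x \in S).
Qed.

(** Independence for uniform colourings, in counting form. Exchanging the
    coordinates in S between two colourings is a bijection that carries the
    pairs with first entry in A :&: B onto the pairs in A x B. *)
Lemma card_setI_indep (A B : {set Omega}) :
    (forall f g : Omega, {in S, f =1 g} -> (f \in A) = (g \in A)) ->
    (forall f g : Omega, {in ~: S, f =1 g} -> (f \in B) = (g \in B)) ->
  (#|A :&: B| * #|Omega| = #|A| * #|B|)%N.
Proof.
move=> dA dB.
rewrite -[#|Omega|]cardsT -!cardsX.
rewrite -(card_preimset (setX A B) (inv_inj swap_offK)).
congr #|pred_of_set _|; apply/setP=> -[f g]; rewrite !inE /= andbT.
congr (_ && _); first by apply: dA => x xS; rewrite ffunE xS.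
by apply: dB => x; rewrite inE => /negPf xS; rewrite ffunE xS.
Qed.

End SwapCoordinates.

Section LocalLemma.
Variables (R : realFieldType) (Omega V : finType).
Variables (bad : V -> {set Omega}) (dep : V -> {set V}) (D : nat) (x : R).

Definition avoid (S : {set V}) : {set Omega} := \bigcap_(u in S) ~: bad u.

Lemma avoid0 : avoid set0 = setT.
Proof. by rewrite /avoid big_set0. Qed.

Lemma avoidU1 u S : avoid (u |: S) = avoid S :\: bad u.
Proof. by rewrite /avoid bigcap_setU big_set1 setIC setDE. Qed.

Lemma avoidS (S1 S2 : {set V}) : S1 \subset S2 -> avoid S2 \subset avoid S1.
Proof.
move=> /subsetP s12; apply/subsetP => w /bigcapP h.
by apply/bigcapP => u /s12; apply: h.
Qed.

Hypotheses (x_ge0 : 0 <= x) (x_lt1 : x < 1).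
Hypothesis dep_le : forall v, (#|dep v| <= D)%N.
Hypothesis indep : forall v (S : {set V}), v \notin S -> [disjoint S & dep v] ->
  (#|bad v :&: avoid S| * #|Omega| = #|bad v| * #|avoid S|)%N.
Hypothesis bad_le : forall v, #|bad v|%:R <= x * (1 - x) ^+ D * #|Omega|%:R.

Lemma avoid_step (S : {set V}) u :
    #|bad u :&: avoid S|%:R <= x * #|avoid S|%:R ->
  (1 - x) * #|avoid S|%:R <= #|avoid (u |: S)|%:R.
Proof.
move=> h; rewrite avoidU1.
have := cardsID (bad u) (avoid S); rewrite setIC => /(congr1 (fun n => n%:R : R)).
by rewrite natrD => e; rewrite mulrBl mul1r; lra.
Qed.

(** The heart of the local lemma: given that the events of S are avoided,
    [bad v] has probability at most x. Split S into the part inside [dep v]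
    and the rest S2. Conditioned on S2 alone, [bad v] keeps its probability
    x (1 - x)^D by independence. Avoiding the at most D remaining events costs
    a factor of at most 1 - x each, by induction on the size of S, so
    conditioning on them raises the probability to at most x. *)
Lemma bad_cond_le (S : {set V}) v :
  #|bad v :&: avoid S|%:R <= x * #|avoid S|%:R.
Proof.
move: {2}#|S|.+1 (ltnSn #|S|) v => n; elim: n S => // n IH S Sn v.
have [vS|vS] := boolP (v \in S).
  suff -> : bad v :&: avoid S = set0.
    by rewrite cards0 mulr_ge0.
  apply/setP => w; rewrite !inE; apply/negbTE/negP => /andP[wb /bigcapP/(_ v vS)].
  by rewrite inE wb.
set S2 := S :\: dep v.
(* The events of S inside [dep v] are added one at a time, each at a factor
   of at least 1 - x. *)
have chain (S' : {set V}) : S' \subset S :&: dep v ->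
    (1 - x) ^+ #|S'| * #|avoid S2|%:R <= #|avoid (S' :|: S2)|%:R.
  move: {2}#|S'| (erefl #|S'|) => k; elim: k S' => [|k IHk] S' cS' sub.
    by move/eqP: cS'; rewrite cards_eq0 => /eqP ->; rewrite cards0 mul1r set0U.
  have /set0Pn [u uS'] : S' != set0 by rewrite -cards_eq0 cS'.
  have cD : #|S' :\ u| = k by move: cS'; rewrite (cardsD1 u) uS' => -[].
  have uS : u \in S /\ u \in dep v by move/subsetP: sub => /(_ u uS') /setIP.
  have sD : S' :\ u \subset S :&: dep v by apply: subset_trans sub; exact: subD1set.
  have -> : S' :|: S2 = u |: (S' :\ u :|: S2) by rewrite setUA setD1K.
  rewrite cS' exprS -mulrA; rewrite -{1}cD.
  apply: le_trans (avoid_step _); last first.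
    apply: IH; rewrite ltnS in Sn; apply: leq_trans Sn.
    apply: proper_card; apply/properP; split.
      apply/subsetP => z; rewrite !inE => /orP[/andP[_ zS']|/andP[_ //]].
      by move/subsetP: sub => /(_ z zS'); rewrite inE => /andP[].
    by exists u; [case: uS | rewrite !inE eqxx uS.2].
  by apply: ler_wpM2l; [rewrite subr_ge0 ltW | exact: IHk].
have chainS := chain _ (subxx _).
rewrite /S2 setUC setUC setID in chainS.
have [O0|O0] := posnP #|Omega|.
  have -> : bad v :&: avoid S = set0.
    by apply/eqP; rewrite -cards_eq0 -leqn0 -O0 max_card.
  by rewrite cards0 mulr_ge0.
have O0' : 0 < #|Omega|%:R :> R by rewrite ltr0n.
have vS2 : v \notin S2 by rewrite inE (negPf vS) andbF.
have disj : [disjoint S2 & dep v].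
  by rewrite -setI_eq0 /S2 setDE -setIA [~: _ :&: _]setIC setICr setI0.
apply: (@le_trans _ _ #|bad v :&: avoid S2|%:R).
  by rewrite ler_nat subset_leq_card // setIS // avoidS // subsetDl.
have /(congr1 (fun n => n%:R : R)) := indep vS2 disj; rewrite !natrM => e.
rewrite -(ler_pM2r O0') e.
apply: (@le_trans _ _ (x * (1 - x) ^+ D * #|Omega|%:R * #|avoid S2|%:R)).
  by rewrite ler_wpM2r.
rewrite -!mulrA ler_wpM2l // [X in _ <= X]mulrC mulrCA ler_wpM2l //.
apply: le_trans chainS; rewrite ler_wpM2r //.
apply: ler_wiXn2l; [by rewrite subr_ge0 ltW | by rewrite lerBlDr lerDl |].
by apply: leq_trans (dep_le v); apply: subset_leq_card; exact: subsetIr.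
Qed.

Lemma local_lemma : (0 < #|Omega|)%N -> exists w, forall v, w \notin bad v.
Proof.
move=> O0.
have pos (s : seq V) : 0 < #|avoid [set z in s]|%:R :> R.
  elim: s => [|v s IH].
    rewrite ltr0n; have -> : [set z in [::]] = set0 :> {set V}.
      by apply/setP=> z; rewrite !inE.
    by rewrite avoid0 cardsT.
  have -> : [set z in v :: s] = v |: [set z in s].
    by apply/setP=> z; rewrite !inE.
  apply: lt_le_trans (avoid_step (bad_cond_le _ _)).
  by rewrite mulr_gt0 // subr_gt0.
move: (pos (enum V)); rewrite ltr0n => /card_gt0P [w /bigcapP h].
by exists w => v; move: (h v); rewrite !inE mem_enum => /(_ isT).
Qed.

End LocalLemma.

(** This turns the weight x = 1/(D+1) of the local lemma into its usual form,
    with the constant e. *)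
Lemma expR1_inv_le (R : realType) (D : nat) : (0 < D)%N ->
  expR (-1) <= (1 - D.+1%:R^-1 : R) ^+ D.
Proof.
move=> D0.
have D0' : 0 < D%:R :> R by rewrite ltr0n.
have -> : 1 - D.+1%:R^-1 = (1 + D%:R^-1)^-1 :> R.
  by rewrite -natr1; field; rewrite !lt0r_neq0 //= ltr_wpDr.
rewrite expRN exprVn lef_pV2 ?posrE ?expR_gt0 ?exprn_gt0 //; last first.
  by rewrite ltr_wpDr // invr_gte0 ltW.
apply: (@le_trans _ _ (expR D%:R^-1 ^+ D)).
  apply: lerXn2r; rewrite ?nnegrE ?expR_ge0 ?expR_ge1Dx //.
  by rewrite addr_ge0 // invr_ge0 ltW.
by rewrite -expRM_natl mulfV // lt0r_neq0.
Qed.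

Lemma half_ge_expR (R : realType) : expR (- (3 / 4)) <= 2^-1 :> R.
Proof.
rewrite expRN lef_pV2 ?posrE ?expR_gt0 //.
have -> : 3 / 4 = 8%:R * (3 / 32) :> R by lra.
(* Powers of 1 + 3/(4m) tend to exp(3/4); m = 8 is large enough to exceed 2. *)
rewrite expRM_natl; apply: (@le_trans _ _ ((1 + 3 / 32) ^+ 8)); first by lra.
by apply: lerXn2r; rewrite ?nnegrE ?expR_ge0 ?expR_ge1Dx //; lra.
Qed.

(** A Chernoff bound for the lower tail. Weight every vertex of N that gets
    colour j by 1/2. A colouring in the set has weight at least 2^-a, which is
    at least exp(-3a/4), while the average weight is
    (1 - 1/(2|C|))^|N| <= exp(-|N|/(2|C|)). For a equal to half of the mean
    |N|/|C| this is exp(-|N|/(8|C|)). *)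
Lemma card_few_colour (R : realType) (I C : finType) (N : {set I}) (j : C)
    (a : R) :
  #|[set f : {ffun I -> C} | #|[set u in N | f u == j]|%:R < a]|%:R <=
    expR (3 / 4 * a - #|N|%:R / (2 * #|C|%:R)) * #|{ffun I -> C}|%:R.
Proof.
set P := #|C|%:R : R; set A := [set f | _].
have P1 : 1 <= P by rewrite /P ler1n; apply/card_gt0P; exists j.
have P0 : 0 < P by apply: lt_le_trans P1.
pose w (u : I) (c : C) : R := if (u \in N) && (c == j) then 2^-1 else 1.
have w0 u c : 0 <= w u c by rewrite /w; case: ifP => _; rewrite ?invr_ge0 ?ler01 ?ler0n.
have wf (f : {ffun I -> C}) : \prod_u w u (f u) =
    2^-1 ^+ #|[set u in N | f u == j]|.
  rewrite -big_mkcond /= prodr_const; congr (_ ^+ _); apply: eq_card => u.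
  by rewrite !inE.
have sumE : \sum_(f : {ffun I -> C}) \prod_u w u (f u) =
    \prod_u (if u \in N then P * (1 - (2 * P)^-1) else P).
  rewrite -bigA_distr_bigA; apply: eq_bigr => u _; rewrite /w.
  case: (u \in N) => /=; last by rewrite sumr_const.
  rewrite (bigD1 j) //= eqxx.
  rewrite (eq_bigr (fun=> 1)); last by move=> c /negPf ->.
  rewrite sumr_const; have -> : #|[pred c | c != j]|%:R = P - 1 :> R.
    by rewrite /P -(cardC (pred1 j)) card1 natrD addrAC subrr add0r.
  by field; rewrite lt0r_neq0.
have lo : expR (- (3 / 4 * a)) * #|A|%:R <=
    \sum_(f : {ffun I -> C}) \prod_u w u (f u).
  apply: (@le_trans _ _ (\sum_(f in A) \prod_u w u (f u))); last first.
    rewrite [X in _ <= X](bigID (mem A)) /= lerDl sumr_ge0 // => f _.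
    exact: prodr_ge0.
  rewrite mulr_natr -sumr_const; apply: ler_sum => f; rewrite inE => fa.
  rewrite wf; set c := #|_| in fa *.
  apply: (@le_trans _ _ (expR (- (3 / 4)) ^+ c)).
    rewrite -expRM_natl ler_expR; lra.
  by apply: lerXn2r; rewrite ?nnegrE ?expR_ge0 ?half_ge_expR ?invr_ge0 ?ler0n.
have hi : \prod_u (if u \in N then P * (1 - (2 * P)^-1) else P) <=
    expR (- (#|N|%:R / (2 * P))) * #|{ffun I -> C}|%:R.
  have -> : #|{ffun I -> C}|%:R = \prod_(u : I) P :> R.
    by rewrite card_ffun natrX prodr_const.
  rewrite -mulrN expRM_natl -prodr_const [X in _ <= X * _]big_mkcond /= -big_split /=.
  apply: ler_prod => u _; case: ifP => _; last by rewrite mul1r lexx ltW.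
  have i0 : 0 <= (2 * P)^-1 by rewrite invr_ge0 mulr_ge0 // ltW.
  have i1 : (2 * P)^-1 <= 1.
    by rewrite invf_le1 ?mulr_gt0 //; lra.
  rewrite mulr_ge0 ?subr_ge0 ?(ltW P0) //=.
  by rewrite [P * _]mulrC ler_pM2r // expR_ge1Dx.
rewrite sumE in lo; move: (le_trans lo hi).
rewrite expRN mulrC ler_pdivrMr ?expR_gt0 // => h; apply: le_trans h _.
rewrite expRD; nra.
Qed.

(** The event [bad v], that some colour is rare around v, is determined by
    the colours of the neighbours of v. It is therefore independent of the
    events at vertices that share no neighbour with v, all but at most
    Delta (Delta - 1) of the others. With probability at most
    K exp(- delta/(8K)), it satisfies the condition of the local lemma exactly
    by the bound on Delta^2. *)
Lemma exists_balanced_colouring (R : realType) (G : sgraph) (P Delta : nat)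
    (delta K : R) :
    (0 < P)%N -> P%:R <= K -> 0 <= delta -> (1 < Delta)%N ->
    (forall v : G, delta <= (vdegree v)%:R) ->
    (forall v : G, (vdegree v <= Delta)%N) ->
    Delta%:R ^+ 2 <= 1 / K * expR (delta / (8 * K) - 1) ->
  exists col : {ffun G -> 'I_P}, forall (v : G) (j : 'I_P),
    delta / (2 * K) <= #|[set u | edge v u & col u == j]|%:R.
Proof.
move=> P0 PK delta0 Delta1 degL degU hDelta.
have P0' : 0 < P%:R :> R by rewrite ltr0n.
have K0 : 0 < K by apply: lt_le_trans PK.
pose nb (v : G) := [set u | edge v u].
have inb (v u : G) : (u \in nb v) = edge v u by rewrite inE.
pose a := delta / (2 * K).
pose bad v := [set f : {ffun G -> 'I_P} |
  [exists j, #|[set u in nb v | f u == j]|%:R < a]].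
pose dep v := [set u | (u != v) && ~~ [disjoint nb u & nb v]].
pose D := (Delta * Delta.-1)%N.
have D0 : (0 < D)%N by rewrite /D muln_gt0; case: (Delta) Delta1 => [|[]].
(* Each dependent u is reached from v by a path v, w, u with u != v. *)
have dep_le v : (#|dep v| <= D)%N.
  apply: (@leq_trans #|\bigcup_(w in nb v) (nb w :\ v)|).
    apply/subset_leq_card/subsetP => u; rewrite inE => /andP[uv].
    rewrite -setI_eq0 => /set0Pn[w]; rewrite !inE => /andP[uw vw].
    apply/bigcupP; exists w; first by rewrite inE.
    by rewrite !inE uv edge_sym.
  apply: leq_trans (leq_card_bigcup _ _) _.
  apply: (@leq_trans (\sum_(w in nb v) Delta.-1)).
    apply: leq_sum => w; rewrite inE => vw.
    have := degU w; rewrite /vdegree -/(nb w) (cardsD1 v) inb edge_sym vw.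
    by rewrite add1n; case: (Delta).
  by rewrite sum_nat_const leq_mul2r degU orbT.
have bad_dep (v : G) (f g : {ffun G -> 'I_P}) : {in nb v, f =1 g} ->
    (f \in bad v) = (g \in bad v).
  move=> fg; rewrite !inE; apply: eq_existsb => j.
  congr (_%:R < _); apply: eq_card => u; rewrite !in_set.
  by have := fg u; rewrite inE; case: (edge v u) => // ->.
have [] := @local_lemma R {ffun G -> 'I_P} G bad dep D D.+1%:R^-1 _ _ dep_le.
- by rewrite invr_ge0.
- by rewrite invf_lt1 ?ltr0n // ltr1n.
- move=> v S vS dis; apply: (@card_setI_indep _ _ (nb v)).
    exact: bad_dep.
  move=> f g fg.
  have agree u : u \in S -> (f \in bad u) = (g \in bad u).
    move=> uS; apply: bad_dep => x xu; apply: fg; rewrite inE.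
    have uv : u != v by apply: contraNneq vS => <-.
    have := disjointFr dis uS; rewrite inE uv /= => /negbFE.
    by move=> /disjointFr/(_ xu) ->.
  by apply/bigcapP/bigcapP => h u uS; have := h u uS; rewrite !in_setC agree.
- move=> v.
  have hsub : bad v \subset \bigcup_(j : 'I_P)
      [set f : {ffun G -> 'I_P} | #|[set u in nb v | f u == j]|%:R < a].
    apply/subsetP => f; rewrite inE => /existsP[j fj].
    by apply/bigcupP; exists j => //; rewrite inE.
  have h1 := leq_trans (subset_leq_card hsub) (leq_card_bigcup _ _).
  set O := #|{ffun G -> 'I_P}|%:R.
  have O0 : 0 <= O :> R by rewrite ler0n.
  have h2 : #|bad v|%:R <= P%:R * expR (- (delta / (8 * K))) * O.
    apply: (@le_trans _ _ (\sum_(j : 'I_P) expR (- (delta / (8 * K))) * O)).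
      rewrite -(ler_nat R) natr_sum in h1; apply: le_trans h1 _.
      apply: ler_sum => j _; apply: le_trans (card_few_colour _ _ _) _.
      rewrite ler_wpM2r // ler_expR card_ord.
      have h3 : delta / (2 * K) <= #|nb v|%:R / (2 * P%:R).
        apply: ler_pM; rewrite ?invr_ge0 ?mulr_ge0 ?ler0n ?(ltW K0) ?degL //.
        by rewrite lef_pV2 ?posrE ?mulr_gt0 // ler_pM2l.
      have -> : 3 / 4 * a = 3 * (delta / (8 * K)) by rewrite /a; field; lra.
      have e4 : delta / (2 * K) = 4 * (delta / (8 * K)) by field; lra.
      rewrite e4 in h3; lra.
    by rewrite sumr_const card_ord -mulrA -[X in X <= _]mulr_natl.
  apply: le_trans h2 _; rewrite ler_wpM2r //.
  have D1pos : 0 < D.+1%:R :> R by rewrite ltr0n.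
  have hD : D.+1%:R <= Delta%:R ^+ 2 :> R.
    rewrite -natrX ler_nat /D; case: (Delta) Delta1 => [|[|q]] // _; lia.
  apply: (@le_trans _ _ (D.+1%:R^-1 * expR (-1))); last first.
    by rewrite ler_wpM2l ?invr_ge0 ?(ltW D1pos) // expR1_inv_le.
  have := le_trans hD hDelta; rewrite expRD => h4.
  apply: (@le_trans _ _ (K * expR (- (delta / (8 * K))))).
    by rewrite ler_wpM2r ?expR_ge0.
  rewrite expRN [_^-1 * _]mulrC.
  rewrite ler_pdivlMr // mulrAC ler_pdivrMr ?expR_gt0 //.
  move: h4; rewrite div1r [_^-1 * _]mulrC ler_pdivlMr // => h4.
  by rewrite mulrC [_ * expR _]mulrC.
- by rewrite card_ffun card_ord expn_gt0 P0.
move=> f hf; exists f => v j.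
have := hf v; rewrite inE negb_exists => /forallP /(_ j); rewrite -leNgt /a.
move=> /le_trans; apply; rewrite ler_nat; apply/subset_leq_card/subsetP => u.
by rewrite !inE.
Qed.

(** * Embedding trees in expanders *)

Section LeafExtension.
Local Open Scope nat_scope.
Variables (H : sgraph) (d m : nat).

(** The invariant of Friedman and Pippenger. B is the image of the part of the
    tree embedded so far, and [c x] is the number of children that x may still
    be asked to receive (d for an unused vertex). Hall's condition is imposed
    on small X only: their unused neighbours can accommodate all the children
    still due. *)
Definition roomy (B : {set H}) (c : H -> nat) : Prop :=
  forall X : {set H}, #|X| <= m -> \sum_(x in X) c x <= #|nbrs X :\: B|.

Hypothesis expansion : forall X : {set H}, #|X| <= m.*2 -> d.+1 * #|X| <= #|nbrs X|.

Lemma nbrsU (X Y : {set H}) : nbrs (X :|: Y) = nbrs X :|: nbrs Y.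
Proof.
apply/setP=> z; rewrite !inE; apply/existsP/orP.
  move=> [x /andP[]]; rewrite inE => /orP[xX|xY] e; [left|right];
    by apply/existsP; exists x; apply/andP.
by case=> /existsP[x /andP[xX e]]; exists x; rewrite inE xX ?orbT.
Qed.

Lemma nbrsI (X Y : {set H}) : nbrs (X :&: Y) \subset nbrs X :&: nbrs Y.
Proof.
apply/subsetP=> z; rewrite !inE => /existsP[x /andP[]].
rewrite inE => /andP[xX xY] e.
by apply/andP; split; apply/existsP; exists x; apply/andP.
Qed.

Lemma nbrs1 (v : H) : nbrs [set v] = [set y | edge v y].
Proof.
apply/setP=> z; rewrite !inE; apply/existsP/idP.
  by move=> [x /andP[]]; rewrite inE => /eqP ->.
by move=> e; exists v; rewrite inE eqxx.
Qed.

Variables (B : {set H}) (c : H -> nat).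
Hypotheses (B_le : #|B| <= m) (c_le : forall x, c x <= d) (roomyB : roomy B c).

Lemma sum_cap_le (X : {set H}) : \sum_(x in X) c x <= d * #|X|.
Proof. by rewrite mulnC -sum_nat_const; apply: leq_sum. Qed.

Lemma nbrs_free_ge (X : {set H}) : #|X| <= m.*2 ->
  d.+1 * #|X| <= #|nbrs X :\: B| + #|B|.
Proof.
move=> /expansion/leq_trans; apply.
by rewrite -[#|nbrs X|](cardsID B) addnC leq_add2l subset_leq_card // subsetIr.
Qed.

(** Beyond size m >= #|B|, expansion alone gives the inequality: the (d + 1)|X|
    neighbours exceed the demand d|X| by |X| > #|B|. *)
Lemma roomy_double (X : {set H}) : #|X| <= m.*2 ->
  \sum_(x in X) c x <= #|nbrs X :\: B|.
Proof.
move=> X2; have [/roomyB //|mX] := leqP #|X| m.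
have := nbrs_free_ge X2; have := sum_cap_le X; rewrite mulSn.
lia.
Qed.

(** Under [roomy] the inequality is an equality: all the free neighbours of X
    are spoken for, and using one of them elsewhere would violate [roomy]. *)
Definition tight (X : {set H}) : bool :=
  (#|X| <= m) && (#|nbrs X :\: B| <= \sum_(x in X) c x).

(** Tight sets are closed under union, because |nbrs X :\: B| is submodular
    whereas the demand is additive. The union is small enough again, since
    expansion forces a set of size at most 2m that meets the inequality to have
    at most #|B| <= m elements. *)
Lemma tightU (X Y : {set H}) : tight X -> tight Y -> tight (X :|: Y).
Proof.
move=> /andP[Xm Xc] /andP[Ym Yc].
have XY2 : #|X :|: Y| <= m.*2 by have := cardsUI X Y; lia.
have sumUI : \sum_(x in X :|: Y) c x + \sum_(x in X :&: Y) c x =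
    \sum_(x in X) c x + \sum_(x in Y) c x.
  rewrite (big_setID X) /= [in RHS](big_setID X (A := Y)) /=.
  rewrite setUK setDUl setDv set0U [Y :&: X]setIC; lia.
have nbrUI : #|nbrs (X :|: Y) :\: B| + #|nbrs (X :&: Y) :\: B| <=
    #|nbrs X :\: B| + #|nbrs Y :\: B|.
  rewrite -[X in _ <= X]cardsUI nbrsU setDUl leq_add2l -setDIl.
  by rewrite subset_leq_card // setSD // nbrsI.
have XYI : #|X :&: Y| <= m by apply: leq_trans Xm; rewrite subset_leq_card // subsetIl.
have := roomyB XYI => hI.
have cU : #|nbrs (X :|: Y) :\: B| <= \sum_(x in X :|: Y) c x by lia.
rewrite /tight cU andbT; apply: leq_trans B_le.
have := nbrs_free_ge XY2; have := sum_cap_le (X :|: Y); rewrite mulSn; lia.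
Qed.

(** If every free neighbour y of v were unusable, each would lie in the
    neighbourhood of a tight set that misses v. Their union X would be tight
    and [nbrs X] would contain every free neighbour of v, so adding v to X would
    raise the demand by [c v] without adding a free neighbour, against
    [roomy_double]. The capacity of y itself stays d: its parent occupies one
    of the d + 1 neighbours that expansion provides. *)
Lemma leaf_extension (v : H) : v \in B -> 0 < c v ->
  exists y, [/\ edge v y, y \notin B &
    roomy (y |: B) (fun x => c x - (x == v))].
Proof.
move=> vB cv.
have m0 : 0 < m by apply: leq_trans B_le; apply/card_gt0P; exists v.
pose c' x := c x - (x == v).
pose fails y := [exists X : {set H}, (#|X| <= m) &&
  (#|nbrs X :\: (y |: B)| < \sum_(x in X) c' x)].
have [/existsP[y /andP[/andP[vy yB] /existsPn ok]]|/existsPn none] :=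
  boolP [exists y, edge v y && (y \notin B) && ~~ fails y].
  exists y; split=> // X Xm; have := ok X; rewrite Xm /=; by rewrite -leqNgt.
have obstruction y : edge v y -> y \notin B ->
    exists X, [/\ tight X, v \notin X & y \in nbrs X].
  move=> vy yB; have := none y; rewrite vy yB /= negbK.
  move=> /existsP[X /andP[Xm hX]]; exists X.
  (* Passing to B with y costs X one neighbour if y is in [nbrs X] and saves
     one unit of demand if v is in X, so failure forces the first without the
     second, and equality before. *)
  have cc' : \sum_(x in X) c' x + (v \in X) = \sum_(x in X) c x.
    have [vX|vX] := boolP (v \in X).
      rewrite !(big_setD1 v vX) /= {1}/c' eqxx.
      have -> : \sum_(i in X :\ v) c' i = \sum_(i in X :\ v) c i.
        by apply: eq_bigr => i; rewrite !inE /c' => /andP[/negPf -> _]; rewrite subn0.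
      lia.
    rewrite addn0; apply: eq_bigr => i iX; rewrite /c'.
    by case: eqP iX vX => [-> -> //|_ _ _]; rewrite subn0.
  have nn : #|nbrs X :\: B| = #|nbrs X :\: (y |: B)| + (y \in nbrs X).
    rewrite (cardsD1 y (nbrs X :\: B)) !inE yB /= addnC; congr (_ + _).
    by congr #|pred_of_set _|; apply/setP=> z; rewrite !inE negb_or andbA.
  move: cc' nn (roomyB Xm) hX; rewrite /tight Xm /=.
  by case: (v \in X); case: (y \in nbrs X) => /= cc' nn hr hX; split=> //; lia.
have cover (ys : seq H) : {subset ys <= [pred y | edge v y && (y \notin B)]} ->
    exists X, [/\ tight X, v \notin X & {subset ys <= nbrs X}].
  elim: ys => [|y ys IH] hys.
    exists set0; split=> //; last by rewrite inE.
    rewrite /tight cards0 /= big_set0 leqn0 cards_eq0.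
    by apply/eqP/setP=> z; rewrite !inE; apply/negbTE/negP => /andP[_ /existsP[x]]; rewrite inE.
  have [|X [tX vX sX]] := IH; first by move=> z zys; apply: hys; rewrite inE zys orbT.
  have /andP[vy yB] := hys y (mem_head _ _).
  have [Y [tY vY yY]] := obstruction y vy yB.
  exists (X :|: Y); split; first exact: tightU.
    by rewrite inE negb_or vX.
  by move=> z; rewrite inE nbrsU inE => /orP[/eqP ->|/sX ->//]; rewrite yY orbT.
have [|X [/andP[Xm Xc] vX sX]] := cover (enum [pred y | edge v y && (y \notin B)]).
  by move=> z; rewrite mem_enum.
have same : nbrs (v |: X) :\: B = nbrs X :\: B.
  apply/setP=> z; rewrite nbrsU nbrs1 !in_setD in_setU.
  have [//|zB /=] := boolP (z \in B); rewrite inE.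
  have [vz/=|//] := boolP (edge v z).
  by apply/esym/sX; rewrite mem_enum inE vz.
have vX2 : #|v |: X| <= m.*2 by rewrite cardsU1 vX; lia.
have := roomy_double vX2; rewrite same big_setU1 //=; lia.
Qed.

End LeafExtension.

(** The vertices of B are embedded in the order of their depth, each next to
    the image of its parent by [leaf_extension]. Here B is any piece, with root
    w, of a larger tree whose parent map is [par]. *)
Lemma rooted_tree_embedding (H : sgraph) (d : nat) (T : finType) (par : T -> T)
    (depth : T -> nat) (B : {set T}) (w : T) (v : H) :
    w \in B ->
    (forall x, x \in B -> x != w -> par x \in B /\ (depth (par x) < depth x)%N) ->
    (forall x, x \in B -> #|[set z in B | z != w & par z == x]| <= d)%N ->
    (forall X : {set H}, #|X| <= (#|B|.-1).*2 -> d.+1 * #|X| <= #|nbrs X|)%N ->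
  exists f : T -> H, [/\ f w = v, {in B &, injective f} &
    forall x, x \in B -> x != w -> edge (f (par x)) (f x)].
Proof.
move=> wB hpar hch hexp.
set m := #|B|.-1 in hexp.
suff main k : (k < #|B|)%N -> exists (S : {set T}) (f : T -> H) (c : H -> nat),
  [/\ S \subset B /\ w \in S, #|S| = k.+1 & f w = v] /\
  [/\ {in S &, injective f}, forall x, x \in S -> x != w -> edge (f (par x)) (f x) &
      forall x, x \in S -> x != w -> par x \in S] /\
  [/\ roomy m (f @: S) c, forall x, (c x <= d)%N,
      forall y, y \notin f @: S -> c y = d &
      forall x, x \in S -> (#|[set z in B :\: S | z != w & par z == x]| <= c (f x))%N].
  have B0 : (0 < #|B|)%N by apply/card_gt0P; exists w.
  have [|S [f [c [[[SB _] Sk fw] [[finj fe _] _]]]]] := main m.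
    by rewrite /m prednK //.
  have SE : S = B by apply/eqP; rewrite eqEcard SB Sk /= /m (prednK B0) leqnn.
  by move: finj fe; rewrite SE => finj fe; exists f.
elim: k => [_|k IH kB].
  exists [set w], (fun=> v), (fun=> d); split; last split.
  - by split; rewrite ?sub1set ?inE ?cards1.
  - split=> [x y|x|x]; rewrite !inE; first by move=> /eqP -> /eqP ->.
      by move=> ->.
    by move=> ->.
  - split=> //; last first.
      move=> x; rewrite inE => /eqP ->; apply: leq_trans (hch w wB).
      by apply/subset_leq_card/subsetP=> z; rewrite !inE => /andP[/andP[_ ->] ->].
    move=> X Xm; rewrite sum_nat_const.
    have -> : [set v | x in [set w]] = [set v] by rewrite imset_set1.
    have X2 : (#|X| <= m.*2)%N by lia.
    have := hexp X X2; rewrite (cardsD1 v (nbrs X)) mulSn mulnC.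
    by case: (v \in nbrs X); case: (#|X|) => [|q]; lia.
have [|S [f [c [[[SB wS] Sk fw] [[finj fe fp] [rm cd cfree cch]]]]]] := IH.
  by apply: ltn_trans kB.
have [x0 x0B x0S] : exists2 x, x \in B & x \notin S.
  have /properP[_ //] : S \proper B by rewrite properEcard SB Sk.
have : x0 \in B :\: S by rewrite inE x0S.
case/(@arg_minnP _ x0 [in B :\: S] depth) => x; rewrite inE => /andP[xS xB] xmin.
have xw : x != w by apply: contraNneq xS => ->.
have [pB pd] := hpar x xB xw.
have pS : par x \in S.
  by apply/negPn/negP => pS; have := xmin (par x); rewrite inE pS pB leqNgt pd => /(_ isT).
have c0 : (0 < c (f (par x)))%N.
  apply: leq_trans (cch _ pS); apply/card_gt0P; exists x.
  by rewrite !inE xS xB xw eqxx.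
have fSm : (#|f @: S| <= m)%N by rewrite card_in_imset // Sk /m; case: #|B| kB.
have [y [ey yS rm']] := leaf_extension hexp fSm cd rm (imset_f f pS) c0.
pose f' z := if z == x then y else f z.
have f'x : f' x = y by rewrite /f' eqxx.
have f'S z : z \in S -> f' z = f z.
  by rewrite /f'; case: eqP => // -> zS; rewrite zS in xS.
have f'im : f' @: (x |: S) = y |: f @: S.
  rewrite imsetU1 f'x; congr (_ |: _); exact: eq_in_imset.
exists (x |: S), f', (fun z => c z - (z == f (par x)))%N; split; last split.
- split; first by rewrite subUset sub1set xB SB !inE wS orbT.
    by rewrite cardsU1 xS Sk.
  by rewrite f'S.
- split=> [z1 z2|z|z].
  + rewrite !inE => /orP[/eqP ->|z1S] /orP[/eqP ->|z2S] //; rewrite ?f'x ?f'S //.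
    * by move=> e; move: yS; rewrite e imset_f.
    * by move=> e; move: yS; rewrite -e imset_f.
    * exact: finj.
  + rewrite inE => /orP[/set1P ->|zS] zw; first by rewrite f'x f'S.
    by rewrite !f'S ?fe ?fp.
  + by rewrite !inE => /orP[/eqP ->|zS] zw; rewrite ?pS ?fp ?orbT.
- split.
  + by rewrite f'im.
  + by move=> z; apply: leq_trans (leq_subr _ _) (cd z).
  + move=> z; rewrite f'im !inE negb_or => /andP[zy zS].
    rewrite cfree //; case: eqP => [e|]; last by rewrite subn0.
    by rewrite e imset_f in zS.
  + move=> z; rewrite inE => /orP[/set1P ->|zS].
      rewrite f'x cfree //; have -> : (y == f (par x)) = false.
        by apply: contraNF yS => /eqP ->; rewrite imset_f.
      rewrite subn0; apply: leq_trans (hch x xB).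
      by apply/subset_leq_card/subsetP=> u; rewrite !inE => /andP[/andP[_ ->] ->].
    rewrite f'S //; have := cch z zS.
    have [->|zp] := eqVneq z (par x).
      rewrite eqxx (cardsD1 x) !inE xS xB xw eqxx /=.
      set U1 := (X in (1 + X <= _)%N -> _); set U2 := (X in _ -> (X <= _)%N).
      suff -> : U2 = U1 by case: (c _) => // q; rewrite add1n ltnS subn1.
      by apply: eq_card => u; rewrite !inE negb_or -!andbA.
    have -> : (f z == f (par x)) = false.
      by apply: contraNF zp => /eqP/finj ->.
    rewrite subn0; apply: leq_trans; apply/subset_leq_card/subsetP=> u.
    by rewrite !inE negb_or => /andP[/andP[/andP[_ ->] ->] ->].
Qed.

(** * Rooted trees and their pieces *)

Section Rooting.
Local Open Scope nat_scope.
Variable T : sgraph.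

Definition is_rooting (r : T) (par : T -> T) (depth : T -> nat) : Prop :=
  (forall x, x != r -> edge x (par x) /\ depth (par x) < depth x) /\
  (forall x y, edge x y -> (x != r /\ par x = y) \/ (y != r /\ par y = x)).

(** [depth] is the distance to an arbitrary root r, and [par x] a neighbour of
    x closer to r. An edge x y of T off the parent relation would close a cycle
    with a simple path of parent edges from x to y. *)
Lemma tree_rooting : is_tree T -> exists r par depth, is_rooting r par depth.
Proof.
move=> [[T0 conn] acyc]; have [r _] := card_gt0P T0.
pose reach x n := [exists p : n.-tuple T, path (@edge T) r p && (last r p == x)].
have reachP x : exists n, reach x n.
  have /connectP [p rp ->] := conn r x; exists (size p).
  by apply/existsP; exists (in_tuple p); rewrite rp eqxx.
pose depth x := ex_minn (reachP x).
have step x : x != r -> exists y, edge x y && (depth y < depth x).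
  move=> xr; rewrite {2}/depth; case: ex_minnP => n /existsP[[p /= /eqP sp]].
  case/lastP: p sp => [|p y] sp /andP[rp /eqP lp] _.
    by rewrite /= in lp; rewrite lp eqxx in xr.
  move: rp sp lp; rewrite rcons_path last_rcons size_rcons => /andP[rp e] sp yx.
  exists (last r p); rewrite -yx edge_sym e -sp ltnS /=.
  rewrite /depth; case: ex_minnP => k _; apply.
  by apply/existsP; exists (in_tuple p); rewrite /= rp eqxx.
pose par x := odflt x [pick y | edge x y && (depth y < depth x)].
have parP x : x != r -> edge x (par x) /\ depth (par x) < depth x.
  move=> /step[y hy]; rewrite /par; case: pickP => [z /andP[] //|/(_ y)].
  by rewrite hy.
exists r, par, depth; split=> // x y exy.
pose e' := [rel a b | (a != r) && (par a == b) || (b != r) && (par b == a)].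
have e'sym : symmetric e' by move=> a b; rewrite /= orbC.
have e'edge : subrel e' (@edge T).
  move=> a b /orP[] /andP[/parP[e _] /eqP <-] //.
  by rewrite edge_sym.
have toroot a : connect e' a r.
  move: {2}(depth a).+1 (ltnSn (depth a)) => n; elim: n a => // n IH a an.
  have [->|ar] := eqVneq a r; first exact: connect0.
  have [_ da] := parP a ar.
  apply: connect_trans (IH (par a) (leq_trans da an)).
  by apply: connect1; rewrite /= ar eqxx.
have /connectP [p0 ep0 yp0] : connect e' x y.
  apply: connect_trans (toroot x) _.
  by rewrite (sym_connect_sym e'sym) toroot.
case/shortenP: ep0 yp0 => p ep up _ yp.
case: p ep up yp => [|z [|z' p]].
- by move=> _ _ yx; move: exy; rewrite yx /= edge_irr.
- move=> /= /andP[e _] _ ->; case/orP: e => /andP[? /eqP ?]; by [left|right].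
move=> ep up yp; have : ucycle (@edge T) [:: x, z, z' & p].
  rewrite /ucycle up andbT /cycle rcons_path (sub_path e'edge ep) -yp.
  by rewrite edge_sym.
by move=> /acyc.
Qed.

Section Pieces.
Variables (r : T) (par : T -> T) (depth : T -> nat).
Hypothesis rooting : is_rooting r par depth.

Definition children (x : T) : {set T} := [set z | (z != r) && (par z == x)].

Lemma card_children_le (x : T) : #|children x| <= maxdeg T.
Proof.
apply: leq_trans (leq_bigmax x); apply/subset_leq_card/subsetP => z.
rewrite !inE => /andP[zr /eqP <-]; rewrite edge_sym.
by case: rooting => /(_ z zr)[].
Qed.

(** The value [par r] is arbitrary, so the step up from the root is excluded. *)
Definition up_step (x y : T) : bool := (x != r) && (par x == y).

Definition descendants (v : T) : {set T} := [set x | connect up_step x v].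

Lemma descendants_self v : v \in descendants v.
Proof. by rewrite inE connect0. Qed.

Lemma descendantsP v x : x \in descendants v ->
  x = v \/ [/\ x != r & par x \in descendants v].
Proof.
rewrite inE => /connectP[[|y p] /= ]; first by left.
move=> /andP[/andP[xr /eqP xy] yp] vp; right; split=> //.
by rewrite inE xy; apply/connectP; exists p.
Qed.

Lemma descendants_par v x : x != r -> par x \in descendants v ->
  x \in descendants v.
Proof.
move=> xr; rewrite !inE => px; apply: connect_trans (connect1 _) px.
by rewrite /up_step xr eqxx.
Qed.

Lemma descendants_depth v x : x \in descendants v -> depth v <= depth x.
Proof.
move: {2}(depth x).+1 (ltnSn (depth x)) => n; elim: n x => // n IH x xn.
case/descendantsP => [-> //|[xr px]].
have [/(_ x xr)[_ dx] _] := rooting.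
by apply: leq_trans (ltnW dx); apply: IH => //; apply: leq_trans dx _.
Qed.

Lemma descendants_children v :
  descendants v \subset v |: \bigcup_(z in children v) descendants z.
Proof.
apply/subsetP => x; rewrite [x \in descendants _]inE => /connectP[p].
case/lastP: p => [|p z]; first by move=> _ /= ->; rewrite setU11.
rewrite rcons_path last_rcons => /andP[xp /andP[zr /eqP pz]] ->.
rewrite in_setU1; apply/orP; right; apply/bigcupP.
exists (last x p); first by rewrite inE zr pz eqxx.
by rewrite inE; apply/connectP; exists p.
Qed.

Definition up_closed (A : {set T}) : Prop :=
  forall x, x \in A -> x != r -> par x \in A.

Lemma up_closed_descendants A v x : up_closed A -> x \in A ->
  x \in descendants v -> v \in A.
Proof.
move=> cA; move: {2}(depth x).+1 (ltnSn (depth x)) => n.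
elim: n x => // n IH x xn xA; case/descendantsP => [<- //|[xr px]].
have [/(_ x xr)[_ dx] _] := rooting.
by apply: (IH (par x)) => //; [apply: leq_trans dx _ | apply: cA].
Qed.

(** Take a deepest v whose subtree inside A has more than k vertices. The
    subtrees of its children have at most k vertices each, and there are at most
    d of them covering at least k vertices, so one has at least k/d. *)
Lemma exists_subtree_size (A : {set T}) (d k : nat) :
    maxdeg T <= d -> 0 < k -> up_closed A -> r \in A -> k < #|A| ->
  exists w, [/\ w \in A, w != r, #|A :&: descendants w| <= k &
    k <= d * #|A :&: descendants w|].
Proof.
move=> Td k0 cA rA kA.
have allr x : x \in descendants r.
  move: {2}(depth x).+1 (ltnSn (depth x)) => n; elim: n x => // n IH x xn.
  have [->|xr] := eqVneq x r; first exact: descendants_self.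
  have [/(_ x xr)[_ dx] _] := rooting.
  by apply: descendants_par => //; apply: IH; apply: leq_trans dx _.
have big_r : k < #|A :&: descendants r|.
  suff -> : descendants r = setT by rewrite setIT.
  by apply/setP => x; rewrite allr inE.
case: (@arg_maxnP _ r (fun v => k < #|A :&: descendants v|) depth big_r).
move=> v big_v vmax.
have small z : z \in children v -> #|A :&: descendants z| <= k.
  rewrite inE leqNgt => /andP[zr /eqP pz]; apply/negP => /vmax /=.
  have [/(_ z zr)[_ dz] _] := rooting.
  by rewrite pz in dz; rewrite leqNgt dz.
have [/existsP[z /andP[zv kz]]|/existsPn none] :=
  boolP [exists z, (z \in children v) && (k <= d * #|A :&: descendants z|)].
  have zr : z != r by move: zv; rewrite inE => /andP[].
  have /set0Pn[x /setIP[xA xz]] : A :&: descendants z != set0.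
    by apply: contraTneq kz => ->; rewrite cards0 muln0 -ltnNge.
  by exists z; split=> //; [exact: up_closed_descendants xA xz | exact: small].
have h : #|A :&: descendants v| <= 1 + \sum_(z in children v) #|A :&: descendants z|.
  apply: leq_trans (leq_add (leqnn _) (leq_card_bigcup _ _)).
  rewrite -(cards1 v); apply: leq_trans (leq_card_setU _ _).
  apply/subset_leq_card/subsetP => x /setIP[xA].
  move=> /(subsetP (descendants_children v)); rewrite !in_setU => /orP[->//|].
  move=> /bigcupP[z zv xz]; apply/orP; right; apply/bigcupP; exists z => //.
  by rewrite inE xA.
have sum_le : d * (\sum_(z in children v) #|A :&: descendants z|) <= d * k.-1.
  rewrite big_distrr /=; apply: (@leq_trans (\sum_(z in children v) k.-1)).
    apply: leq_sum => z zv; have := none z; rewrite zv /= -ltnNge.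
    by case: (k) k0.
  by rewrite sum_nat_const leq_mul2r (leq_trans (card_children_le v) Td) orbT.
have d0 : 0 < d.
  rewrite lt0n; apply/eqP => d0; move: h; rewrite big1 ?addn0.
    by move=> /(leq_trans big_v); rewrite ltnS leqNgt k0.
  move=> z zv; have := leq_trans (card_children_le v) Td.
  by rewrite d0 leqn0 cards_eq0 => /eqP e; rewrite e inE in zv.
rewrite leq_pmul2l // in sum_le.
have := leq_trans big_v (leq_trans h (leq_add (leqnn 1) sum_le)).
by rewrite add1n prednK // ltnn.
Qed.

End Pieces.
End Rooting.

(** * Embedding the tree in stages *)

(** Discarding a heaviest element never increases the average weight. *)
Lemma exists_light_subset (I : finType) (F : I -> nat) (s : nat) :
    (s <= #|I|)%N ->
  exists J : {set I}, #|J| = s /\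
    (#|I| * (\sum_(i in J) F i) <= s * (\sum_i F i))%N.
Proof.
move=> sI; rewrite -(subKn sI); move: (#|I| - s)%N (leq_subr s #|I|) => k.
elim: k => [_|k IH kI].
  exists setT; rewrite cardsT subn0; split=> //.
  by rewrite leq_mul2l leq_eqVlt (eq_bigl xpredT) ?eqxx ?orbT // => i; rewrite inE.
have [J [cJ wJ]] := IH (ltnW kI).
have cJ' : #|J| = (#|I| - k.+1).+1 by rewrite cJ -subSn.
have [i0 i0J] : exists i, i \in J by apply/card_gt0P; rewrite cJ'.
case: (@arg_maxnP _ i0 (fun i => i \in J) F i0J) => j jJ jmax.
exists (J :\ j); split.
  by apply/eqP; rewrite -eqSS -cJ' (cardsD1 j J) jJ.
move: wJ; rewrite -cJ cJ'; set t := (#|I| - k.+1)%N in cJ' *.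
have : (\sum_(i in J) F i <= t.+1 * F j)%N.
  rewrite -cJ' -sum_nat_const; apply: leq_sum => i iJ; exact: jmax.
rewrite (big_setD1 j jJ) /=; set S := (\sum_(i in J :\ j) F i)%N.
set Z := (\sum_i F i)%N; move: (#|I|) => P; rewrite mulSn leq_add2l => h1 h2.
have h3 : (t.+1 * S <= t * (F j + S))%N by rewrite mulnDr mulSn leq_add2r.
rewrite -(leq_pmul2l (ltn0Sn t)) mulnCA.
apply: leq_trans (leq_mul (leqnn P) h3) _.
by rewrite mulnCA [X in (_ <= X)%N]mulnCA leq_mul2l h2 orbT.
Qed.

Lemma mindeg_le (H : sgraph) (x : H) : (mindeg H <= vdegree x)%N.
Proof.
rewrite /mindeg; have : x \in index_enum H by rewrite mem_index_enum.
elim: (index_enum H) => // y s IH; rewrite inE big_cons geq_min.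
by case/orP => [/eqP ->|/IH ->]; rewrite ?leqnn ?orbT.
Qed.

Lemma mindeg_ge (R : realType) (H : sgraph) (q : R) : (0 < #|H|)%N ->
  (forall x : H, q <= (vdegree x)%:R) -> q <= (mindeg H)%:R.
Proof.
move=> /card_gt0P[x0 _] hq; rewrite /mindeg; elim/big_ind: _ => //.
  by apply: le_trans (hq x0) _; rewrite ler_nat max_card.
by move=> a b qa qb; rewrite /minn; case: ifP.
Qed.

Lemma vdegree_induced (G : sgraph) (U : {set G}) (x : induced_sub U) :
  vdegree x = #|[set u in U | edge (val x) u]|.
Proof.
rewrite /vdegree -(card_imset _ (@val_inj _ _ {x : G | x \in U})).
apply: eq_card => u; apply/imsetP/idP.
  by move=> [y]; rewrite !inE => e ->; rewrite (valP y).
rewrite !inE => /andP[uU e].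
by exists (Sub u uU : induced_sub U); rewrite ?inE ?SubK //= /induced_edge SubK.
Qed.

Lemma card_induced (G : sgraph) (U : {set G}) : #|induced_sub U| = #|U|.
Proof. by rewrite card_sig; apply: eq_card => x; rewrite inE. Qed.

Lemma mindeg_induced_ge (R : realType) (G : sgraph) (U W : {set G}) (q : R) :
    (0 < #|U|)%N -> W \subset U ->
    (forall x : G, q <= #|[set u in W | edge x u]|%:R) ->
  q <= (mindeg (induced_sub U))%:R.
Proof.
move=> U0 /subsetP WU hq; apply: mindeg_ge; first by rewrite card_induced.
move=> x; rewrite vdegree_induced; apply: le_trans (hq (val x)) _.
rewrite ler_nat; apply/subset_leq_card/subsetP => u; rewrite !inE.
by move=> /andP[/WU -> ->].
Qed.

(** The tree embedding for a piece B of T, once local expansion applies to the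
    vertex set U: a piece on k vertices needs expansion of the sets of size at
    most 2(k - 1), which the expander provides up to |U|/(2d+2). *)
Lemma embed_in_induced (R : realType) (d : nat) (G : sgraph) (U : {set G})
    (T : finType) (par : T -> T) (depth : T -> nat) (B : {set T}) (w : T)
    (v : G) :
    v \in U -> expander (1 / (2 * d%:R + 2) : R) (d%:R + 1) (induced_sub U) ->
    (2 * (#|B|.-1)%:R <= 1 / (2 * d%:R + 2) * #|U|%:R :> R) ->
    w \in B ->
    (forall x, x \in B -> x != w -> par x \in B /\ (depth (par x) < depth x)%N) ->
    (forall x, x \in B -> #|[set z in B | z != w & par z == x]| <= d)%N ->
  exists f : T -> G, [/\ f w = v, forall x, f x \in U, {in B &, injective f} &
    forall x, x \in B -> x != w -> edge (f (par x)) (f x)].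
Proof.
move=> vU hexp hB wB hpar hch.
have [X hX|f [fw finj fe]] := rooted_tree_embedding (Sub v vU : induced_sub U)
    wB hpar hch.
  have X_le : #|X|%:R <= 1 / (2 * d%:R + 2) * #|induced_sub U|%:R :> R.
    by rewrite card_induced; apply: le_trans hB; rewrite -natrM ler_nat mul2n.
  by have := hexp X X_le; rewrite natr1 -natrM ler_nat.
exists (fun x => val (f x)); split=> //.
- by rewrite fw SubK.
- by move=> x; exact: valP.
- by move=> x y xB yB /val_inj; apply: finj.
Qed.

(** The induction runs over the colours that remain reserved: [J'] are those
    to be avoided when the rooted subtree A of T is embedded, and the condition
    on #|A| says that enough colours have been released for its size. A subtree
    B is cut off A, the rest of A is embedded with one more colour j reserved,
    and B is then placed in the graph induced on the unused vertices outside
    [J'], which contains all vertices of colour j. *)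
Lemma staged_embedding (R : realType) (d : nat) (G T : sgraph) (C : finType)
    (col : G -> C) (J : {set C}) (q rho : R)
    (r : T) (par : T -> T) (depth : T -> nat) :
    (0 < d)%N -> is_rooting r par depth -> (maxdeg T <= d)%N ->
    0 < rho -> #|T|%:R + 2 * rho <= #|G|%:R ->
    #|[set v | col v \in J]|%:R <= rho ->
    #|T|%:R + rho <= rho * (1 + (4 * d%:R * (d%:R + 1))^-1) ^+ #|J| ->
    0 < q ->
    (forall v j, q <= #|[set u | edge v u & col u == j]|%:R) ->
    (forall U : {set G}, q <= (mindeg (induced_sub U))%:R ->
      expander (1 / (2 * d%:R + 2) : R) (d%:R + 1) (induced_sub U)) ->
  contains_copy G T.
Proof.
move=> d0 root Td rho0 hG hJ hbig q0 hq hexp.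
have d0' : 0 < d%:R :> R by rewrite ltr0n.
set g := (4 * d%:R * (d%:R + 1))^-1 in hbig.
have g0 : 0 < g by rewrite invr_gt0 !mulr_gt0 // ltr_wpDr.
have colour_nbr v j : exists u, edge v u /\ col u = j.
  have : 0 < #|[set u | edge v u & col u == j]|%:R :> R by apply: lt_le_trans (hq v j).
  rewrite ltr0n => /card_gt0P[u]; rewrite inE => /andP[e /eqP].
  by exists u.
have [v0 _] : exists v : G, v \in G.
  apply/card_gt0P; rewrite -(ltr0n R); apply: lt_le_trans hG.
  by rewrite ltr_wpDl ?ler0n ?mulr_gt0.
have hcolour (U : {set G}) (j : C) : (forall u, col u = j -> u \in U) ->
    expander (1 / (2 * d%:R + 2) : R) (d%:R + 1) (induced_sub U).
  move=> jU; apply: hexp; apply: (@mindeg_induced_ge _ _ _ [set u | col u == j]).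
  - by have [u [_ /jU uU]] := colour_nbr v0 j; apply/card_gt0P; exists u.
  - by apply/subsetP => u; rewrite inE => /eqP/jU.
  - move=> x; apply: le_trans (hq x j) _; rewrite ler_nat.
    by apply/subset_leq_card/subsetP => u; rewrite !inE andbC.
have hpar x : x != r -> edge x (par x) /\ (depth (par x) < depth x)%N.
  by case: root => h _; apply: h.
have hchild (B : {set T}) w : (forall x, x \in B -> x != w -> x != r) ->
    forall x, (#|[set z in B | z != w & par z == x]| <= d)%N.
  move=> hB x; apply: leq_trans Td.
  apply: leq_trans (card_children_le root x).
  apply/subset_leq_card/subsetP => z; rewrite !inE.
  by move=> /andP[zB /andP[zw ->]]; rewrite (hB z).
suff main m (J' : {set C}) (A : {set T}) :
    J' \subset J -> (#|J| = #|J'| + m)%N -> up_closed r par A -> r \in A ->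
    rho * (1 + g) ^+ #|J'| <= #|T|%:R - #|A|%:R + rho ->
    exists f : T -> G, [/\ {in A &, injective f},
      forall x, x \in A -> x != r -> edge (f (par x)) (f x) &
      forall x, x \in A -> col (f x) \notin J'].
  have [|||||f [finj fe _]] := main #|J| set0 setT.
  - exact: sub0set.
  - by rewrite cards0.
  - by move=> x; rewrite !inE.
  - by rewrite inE.
  - by rewrite cards0 cardsT subrr add0r mulr1.
  exists f; split=> [x y|x y]; first by apply: finj; rewrite inE.
  have [_ h] := root; move=> /h[[xr <-]|[yr <-]].
    by rewrite edge_sym fe // inE.
  by rewrite fe // inE.
elim: m J' A => [|m IH] J' A J'J cJ cA rA size_A.
  rewrite addn0 in cJ; rewrite -cJ in size_A.
  have : 0 < #|A|%:R :> R by rewrite ltr0n; apply/card_gt0P; exists r.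
  by have := le_trans hbig size_A; lra.
have [j jJ jJ'] : exists2 j, j \in J & j \notin J'.
  have /properP[_ //] : J' \proper J.
  by rewrite properEcard J'J cJ addnS ltnS leq_addr.
(* The choice k = floor(y) + 1 suits both sides: pieces of at most k vertices
   need expansion up to size 2 floor(y) <= 2y only, while k >= y makes the
   piece cut off have at least y/d vertices. *)
pose y : R := (#|T|%:R - #|A|%:R + rho) / (4 * d%:R + 4).
have dd0 : 0 < 4 * d%:R + 4 :> R by lra.
have A0 : 0 <= #|A|%:R :> R by [].
have AT : #|A|%:R <= #|T|%:R :> R by rewrite ler_nat max_card.
have y0 : 0 <= y by apply: divr_ge0; lra.
have yE : #|T|%:R - #|A|%:R + rho = (4 * d%:R + 4) * y.
  by rewrite /y mulrC divfK // lt0r_neq0.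
pose k := (Num.truncn y).+1.
have k_up b : (b <= k)%N -> 2 * (b.-1)%:R <= 2 * y.
  move=> bk; rewrite ler_pM2l //.
  have : (Num.truncn y)%:R <= y by rewrite truncn_le.
  by apply: le_trans; rewrite ler_nat -ltnS; case: b bk.
have k_lo : y <= k%:R by apply/ltW/truncnS_gt.
have room (U : {set G}) (b : nat) : (b <= k)%N -> #|T|%:R - #|A|%:R + rho <= #|U|%:R ->
    2 * (b.-1)%:R <= 1 / (2 * d%:R + 2) * #|U|%:R :> R.
  move=> /k_up bk hU; apply: le_trans bk _; rewrite yE in hU.
  rewrite mulrAC ler_pdivlMr; lra.
have card_avoid : #|G|%:R - rho <= #|[set v | col v \notin J']|%:R.
  have hs : #|[set v | col v \in J']|%:R <= rho.
    apply: le_trans hJ; rewrite ler_nat; apply/subset_leq_card/subsetP => v.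
    by rewrite !inE => /(subsetP J'J).
  have := cardsC [set v | col v \in J'] => /(congr1 (fun n => n%:R : R)).
  rewrite natrD; have -> : ~: [set v | col v \in J'] = [set v | col v \notin J'].
    by apply/setP => v; rewrite !inE.
  lra.
have [Ak|kA] := leqP #|A| k.
  pose U := [set v | col v \notin J'].
  have [u [_ uj]] := colour_nbr v0 j.
  have jU x : col x = j -> x \in U by rewrite inE => ->.
  have card_U : #|T|%:R - #|A|%:R + rho <= #|U|%:R by rewrite /U; lra.
  have [||f [_ fU finj fe]] := embed_in_induced (depth := depth) (par := par)
      (jU u uj) (hcolour U j jU) (room U _ Ak card_U) rA.
  - by move=> x xA xr; split; [exact: cA | case: (hpar x xr)].
  - by move=> x _; apply: hchild.
  exists f; split=> // x _; by have := fU x; rewrite inE.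
have [w [wA wr Bk kB]] := exists_subtree_size root Td (ltn0Sn _) cA rA kA.
set Dw := descendants r par w in Bk kB; set B := A :&: Dw in Bk kB.
have wDw : w \in Dw by exact: descendants_self.
have wB : w \in B by rewrite inE wA.
have rDw : r \notin Dw.
  apply/negP => /descendantsP[rw|[/negP//]]; by rewrite rw eqxx in wr.
pose A' := A :\: Dw.
have cA' : up_closed r par A'.
  move=> x; rewrite !in_setD => /andP[xD xA] xr; rewrite cA // andbT.
  by apply: contra xD => px; exact: descendants_par xr px.
have rA' : r \in A' by rewrite in_setD rDw.
have cAB : #|A|%:R = #|B|%:R + #|A'|%:R :> R.
  by rewrite -natrD -(cardsID Dw A).
have [|||f' [finj' fe' fcol']] := IH (j |: J') A' _ _ cA' rA' _.
- by rewrite subUset sub1set jJ.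
- by rewrite cardsU1 jJ' cJ addnS add1n addSn.
- rewrite cardsU1 jJ' exprS mulrCA.
  apply: (@le_trans _ _ ((1 + g) * (#|T|%:R - #|A|%:R + rho))).
    by rewrite ler_wpM2l // addr_ge0 // ltW.
  have -> : #|T|%:R - #|A'|%:R + rho = (#|T|%:R - #|A|%:R + rho) + #|B|%:R.
    by rewrite cAB; ring.
  rewrite mulrDl mul1r lerD2l yE.
  have -> : g * ((4 * d%:R + 4) * y) = y / d%:R.
    rewrite /g; field; rewrite !lt0r_neq0 //; lra.
  rewrite ler_pdivrMr // mulrC -natrM; apply: le_trans k_lo _.
  by rewrite ler_nat.
pose U := [set v | (col v \notin J') && (v \notin f' @: A')].
have jU x : col x = j -> x \in U.
  move=> xj; rewrite inE xj jJ' /=; apply/imsetP => -[z zA' xz].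
  by have := fcol' z zA'; rewrite -xz xj setU11.
have [u [eu uj]] := colour_nbr (f' (par w)) j.
have card_U : #|T|%:R - #|A|%:R + rho <= #|U|%:R.
  have -> : U = [set v | col v \notin J'] :\: (f' @: A').
    by apply/setP => v; rewrite !inE andbC.
  have := cardsID (f' @: A') [set v | col v \notin J'].
  move=> /(congr1 (fun n => n%:R : R)); rewrite natrD.
  have : #|[set v | col v \notin J'] :&: f' @: A'|%:R <= #|A'|%:R :> R.
    rewrite ler_nat; apply: leq_trans (leq_imset_card f' _).
    by rewrite subset_leq_card // subsetIr.
  have : 0 <= #|B|%:R :> R by [].
  lra.
have Bpar x : x \in B -> x != w -> x != r /\ par x \in B.
  rewrite inE => /andP[xA /descendantsP[->|[xr px]]]; first by rewrite eqxx.
  by move=> _; rewrite inE px cA.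
have [||g' [gw gU ginj ge]] := embed_in_induced (depth := depth) (par := par) (jU u uj)
    (hcolour U j jU) (room U _ Bk card_U) wB.
- by move=> x xB xw; have [xr px] := Bpar x xB xw; split=> //; case: (hpar x xr).
- move=> x _; apply: hchild => z zB zw; by case: (Bpar z zB zw).
have AE x : x \in A -> (x \in B) = (x \in Dw) by rewrite inE => ->.
have A'E x : x \in A -> (x \in A') = (x \notin Dw) by rewrite inE => ->; rewrite andbT.
have cross x z : z \in A' -> g' x <> f' z.
  move=> zA' e; have := gU x; rewrite inE => /andP[_ /negP]; apply.
  by rewrite e imset_f.
exists (fun x => if x \in Dw then g' x else f' x); split.
- move=> x z xA zA; case: (boolP (x \in Dw)) (boolP (z \in Dw)) => xD [] zD.
  + by apply: ginj; rewrite AE.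
  + by move=> /cross[]; rewrite A'E.
  + by move=> /esym/cross[]; rewrite A'E.
  + by apply: finj'; rewrite A'E.
- move=> x xA xr; case: (boolP (x \in Dw)) => xD; last first.
    have xA' : x \in A' by rewrite A'E.
    have := cA' x xA' xr; rewrite inE => /andP[/negPf -> _]; exact: fe'.
  have [->|xw] := eqVneq x w.
    have -> : (par w \in Dw) = false.
      apply/negP => /(descendants_depth root).
      by have [_] := hpar w wr; rewrite ltnNge => /negP.
    by rewrite gw.
  have xB : x \in B by rewrite AE.
  have [_] := Bpar x xB xw; rewrite inE => /andP[_ ->]; exact: ge.
- move=> x xA; case: (boolP (x \in Dw)) => xD.
    by have := gU x; rewrite inE => /andP[].
  by have := fcol' x; rewrite A'E // xD !inE negb_or => /(_ isT)/andP[].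
Qed.

(** * Numerical estimates and the conclusion *)

Lemma ln_ratio_ge (R : realType) (eps : R) : 0 < eps -> eps < 1 / 2 ->
  3 / 4 <= ln (2 / eps).
Proof.
move=> e0 e1; have h0 : 0 < 2 / eps by rewrite divr_gt0.
rewrite -ler_expR lnK ?posrE // ler_pdivlMr //.
have := expR_ge1Dx (- (3 / 4) : R); rewrite expRN => h.
have e34 : 0 < expR (3 / 4) :> R := expR_gt0 _.
have : expR (3 / 4) <= 4 :> R.
  by rewrite -lef_pV2 ?posrE //; apply: le_trans h; lra.
nra.
Qed.

(** With g = 1/(4d(d+1)) one has 1/(1 + g) = 1 - 1/(2d+1)^2, which is at most
    exp(-1/(2d+1)^2). *)
Lemma growth_ge (R : realType) (d s : nat) (L : R) : (0 < d)%N ->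
    (2 * d%:R + 1) ^+ 2 * L <= s%:R ->
  expR L <= (1 + (4 * d%:R * (d%:R + 1))^-1) ^+ s.
Proof.
move=> d0 hs; have d0' : 0 < d%:R :> R by rewrite ltr0n.
have D0 : 0 < (2 * d%:R + 1) ^+ 2 :> R by rewrite exprn_gt0 //; lra.
set g := _^-1.
have g0 : 0 < g by rewrite invr_gt0 !mulr_gt0 // ltr_wpDr.
have gE : (1 + g)^-1 = 1 - ((2 * d%:R + 1) ^+ 2)^-1.
  rewrite /g; field; rewrite !lt0r_neq0 //; nra.
apply: (@le_trans _ _ (expR ((2 * d%:R + 1) ^+ 2)^-1 ^+ s)).
  rewrite -expRM_natl ler_expR ler_pdivlMr //; lra.
apply: lerXn2r; rewrite ?nnegrE ?expR_ge0 ?addr_ge0 ?(ltW g0) //.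
rewrite -lef_pV2 ?posrE ?expR_gt0 ?addr_gt0 // gE -expRN.
exact: expR_ge1Dx.
Qed.

Theorem theorem1p4 (R : realType) (d : nat) (eps : R) (G : sgraph)
    (n delta Delta : nat) (K : R)
    (hd : (2 <= d)%N) (heps0 : 0 < eps) (heps1 : eps < 1 / 2)
    (hn : n = #|G|) (hdelta : delta = mindeg G) (hDelta : Delta = maxdeg G)
    (hK : K = 20 * d%:R ^+ 2 * ln (2 / eps) / eps)
    (horder : 480 * d%:R ^+ 3 * ln (2 / eps) / eps <= n%:R)
    (hmaxdeg : Delta%:R ^+ 2 <= 1 / K * expR (delta%:R / (8 * K) - 1))
    (hexp : forall U : {set G},
        eps * delta%:R / (40 * d%:R ^+ 2 * ln (2 / eps))
          <= (mindeg (induced_sub U))%:R ->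
        expander (1 / (2 * d%:R + 2) : R) (d%:R + 1) (induced_sub U)) :
  forall T : sgraph,
    is_tree T -> #|T|%:R <= (1 - eps) * n%:R -> (maxdeg T <= d)%N ->
    contains_copy G T.
Proof.
move=> T Ttree Tcard Tdeg.
set L := ln (2 / eps) in hK horder hexp.
have L34 : 3 / 4 <= L by exact: ln_ratio_ge.
have dR : 2 <= d%:R :> R by rewrite ler_nat.
have d2 : 4 <= d%:R ^+ 2 :> R by rewrite expr2; nra.
have KE : eps * K = 20 * d%:R ^+ 2 * L by rewrite hK mulrC divfK // lt0r_neq0.
have d2L : 3 <= d%:R ^+ 2 * L by nra.
have K60 : 60 <= K by nra.
have K0 : 0 < K by lra.
have n_big : 2 * d%:R + 2 <= n%:R :> R.
  apply: le_trans horder; rewrite ler_pdivlMr // !exprS expr0 mulr1.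
  have : 2 * d%:R <= d%:R * (d%:R * d%:R) * L :> R by rewrite expr2 in d2L; nra.
  rewrite expr2 in d2L; nra.
have n0 : 0 < n%:R :> R by lra.
have thE : eps * delta%:R / (40 * d%:R ^+ 2 * L) = delta%:R / (2 * K).
  rewrite hK; field; rewrite !lt0r_neq0 //; lra.
rewrite thE in hexp.
have degL (v : G) : delta%:R <= (vdegree v)%:R :> R.
  by rewrite ler_nat hdelta mindeg_le.
have degU (v : G) : (vdegree v <= Delta)%N.
  by rewrite hDelta; apply: leq_bigmax.
have delta_ge0 : 0 <= delta%:R :> R by [].
have nG : (0 < #|G|)%N by rewrite -hn -(ltr0n R).
have expG : expander (1 / (2 * d%:R + 2) : R) (d%:R + 1) (induced_sub [set: G]).
  apply: hexp; apply: (@mindeg_induced_ge _ _ _ setT); rewrite ?cardsT // => v.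
  apply: le_trans (_ : (vdegree v)%:R <= _); last first.
    by rewrite ler_nat; apply/subset_leq_card/subsetP => u; rewrite !inE.
  apply: le_trans (degL v); rewrite ler_pdivrMr; last lra.
  by rewrite ler_peMr //; lra.
(* Expansion of G itself at single vertices excludes small degrees; this
   yields delta > 0 and the bound Delta > 1 used by the local lemma. *)
have deg_big (v : G) : (d < vdegree v)%N.
  pose v' : induced_sub [set: G] := Sub v (in_setT v).
  have := expG [set v']; rewrite cards1 card_induced cardsT -hn => h.
  have {h} := h _; rewrite mulr1 natr1 ler_nat nbrs1 => h.
  apply: leq_trans (h _) _.
    rewrite mulrAC ler_pdivlMr; lra.
  rewrite -/(vdegree v') vdegree_induced; apply/subset_leq_card/subsetP => u.
  by rewrite !inE SubK.
have delta1 : 1 <= delta%:R :> R.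
  rewrite hdelta; apply: mindeg_ge => // v; rewrite ler1n.
  by apply: leq_ltn_trans (deg_big v).
have Delta1 : (1 < Delta)%N.
  have [v0 _] := card_gt0P nG.
  by apply: leq_trans (degU v0); apply: leq_trans (deg_big v0); apply: leqW.
pose P := Num.truncn K.
have PK : P%:R <= K by rewrite truncn_le ltW.
have PK1 : K < P%:R + 1 by rewrite natr1 truncnS_gt.
have P0 : (0 < P)%N by rewrite truncn_gt0; lra.
have P0' : 0 < P%:R :> R by rewrite ltr0n.
have [col hcol] := exists_balanced_colouring P0 PK delta_ge0 Delta1 degL degU hmaxdeg.
pose s := (Num.truncn ((2 * d%:R + 1) ^+ 2 * L)).+1.
have dd0 : 0 <= (2 * d%:R + 1) ^+ 2 * L by rewrite mulr_ge0 ?sqr_ge0 //; lra.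
have s_lo : (2 * d%:R + 1) ^+ 2 * L <= s%:R by apply/ltW/truncnS_gt.
have s_up : s%:R <= (2 * d%:R + 1) ^+ 2 * L + 1.
  by rewrite /s -(natr1 (Num.truncn _)) lerD2r truncn_le.
(* (2d+1)^2 <= 25/4 d^2 for d >= 2, which leaves room for both roundings. *)
have sP : 2 * s%:R <= eps * P%:R :> R.
  have h1 : eps * K <= eps * P%:R + 1 by nra.
  have h2 : (2 * d%:R + 1) ^+ 2 * L <= 25 / 4 * (d%:R ^+ 2 * L).
    by rewrite mulrA ler_wpM2r; nra.
  lra.
have sP' : (s <= #|'I_P|)%N.
  rewrite card_ord -(ler_nat R); nra.
have [J [cJ wJ]] := exists_light_subset (fun j => #|[set v | col v == j]|) sP'.
have cG : (\sum_(j : 'I_P) #|[set v | col v == j]| = n)%N.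
  rewrite hn -sum1_card (partition_big col xpredT) //=.
  by apply: eq_bigr => j _; rewrite sum1_card; apply: eq_card => v; rewrite !inE.
have cJG : (#|[set v | col v \in J]| = \sum_(j in J) #|[set v | col v == j]|)%N.
  rewrite -sum1_card (partition_big col (mem J)) /=; last by move=> v; rewrite inE.
  apply: eq_bigr => j jJ; rewrite -sum1_card; apply: eq_bigl => v; rewrite !inE.
  by case: eqP => [->|_]; rewrite ?jJ ?andbF.
pose rho := eps * n%:R / 2.
have [r [par [depth root]]] := tree_rooting Ttree.
apply: (@staged_embedding R d G T 'I_P col J (delta%:R / (2 * K)) rho r par depth) => //.
- exact: ltnW.
- by rewrite /rho divr_gt0 // mulr_gt0.
- by rewrite -hn /rho; lra.
- rewrite cJG; rewrite -cJG in wJ *; rewrite card_ord cG in wJ.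
  move: wJ; rewrite -(ler_nat R) !natrM => wJ.
  rewrite -(ler_pM2l P0'); apply: le_trans wJ _.
  by rewrite /rho; nra.
- have hg := @growth_ge R d s L (ltnW hd) s_lo.
  rewrite cJ; apply: (@le_trans _ _ (rho * expR L)); last first.
    by rewrite ler_wpM2l // /rho divr_ge0 // mulr_ge0 // ltW.
  have -> : rho * expR L = n%:R.
    rewrite /L lnK ?posrE ?divr_gt0 // /rho; field; exact: lt0r_neq0.
  by rewrite /rho; nra.
- rewrite divr_gt0 //; lra.
Qed.
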